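(* Let $\mathbf{M}=(\mathbf{C},\mathbf{N},\mathrm{pr})$ be a finitary cover structure satisfying conditions C1, C2 and C3, which is non-trivial, i.e. $|\mathrm{Aut}(\mathbf{M}/N)|>1$, and assume that section-imaginaries for $i_{\mathrm{pr}}$ are eliminable. Let $\hat{i}_{\mathrm{pr}}:\mathrm{Aut}(\mathbf{M})\twoheadrightarrow \mathrm{Aut}(\mathbf{N})$ be the restriction homomorphism. Then there exists a section $\hat{g}:\mathrm{Aut}(\mathbf{N})\to\mathrm{Aut}(\mathbf{M})$ of $\hat{i}_{\mathrm{pr}}$ (a homomorphism with $\hat{i}_{\mathrm{pr}}\circ\hat{g}=\mathrm{id}_{\mathrm{Aut}(\mathbf{N})}$) if and only if there is a definable point in $\mathbf{N}$, i.e. $\mathrm{dcl}(\emptyset)\cap N\neq\emptyset$.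
   Context: Structures are multi-sorted and considered in a language powerful enough that a subset of a structure is definable (without parameters) iff it is invariant under all automorphisms of the structure. A sort of $\mathbf{M}$ is $D/E$ with $D$ a parameter-free definable subset of a product of sorts and $E$ a definable equivalence relation; $\mathbf{M}^{Eq}$ is the structure having all such sorts; $\mathbf{M}^{eq}$ is the usual extension by first-order imaginaries. $\mathrm{dcl}$ denotes definable closure (in $\mathbf{M}^{Eq}$ unless indicated). For $A\subseteq \mathbf{M}^{Eq}$, $\mathbf{M}/A$ is the expansion of $\mathbf{M}$ by names for the elements of $A$, and $\mathrm{Aut}(\mathbf{M}/A)$ is the group of automorphisms fixing $A$ pointwise. An interpretation (pre-morphism) $g:\mathbf{N}\to\mathbf{M}$ is an injective map $N\to \mathbf{M}^{Eq}$ onto a sort such that the image of each basic relation of $\mathbf{N}$ is definable; it is an embedding if every relation on $gN$ definable in $\mathbf{M}^{Eq}$ is already definable in the structure $g\mathbf{N}$, a surjection if $M\subseteq\mathrm{dcl}(gN)$, and an $\mathfrak{M}$-isomorphism if both. A structure $\mathbf{M}$ is finitary if $\mathbf{M}=\bigcup_{\alpha<\kappa}\mathbf{M}_\alpha$ with each $\mathbf{M}_\alpha$ a finite first-order $0$-definable substructure (equivalently $M=\mathrm{acl}(\emptyset)$ in the first-order sense). A cover structure is a two-sorted structure $\mathbf{M}=(\mathbf{C},\mathbf{N},\mathrm{pr})$ where $\mathbf{C},\mathbf{N}$ are substructures with universes $C,N$, $\mathrm{pr}:C\twoheadrightarrow N$ is a surjective map with finite fibres, and the image under $\mathrm{pr}$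 of every definable relation $R\subseteq C^n$ is definable in $\mathbf{N}$. The identity on $N$ gives an interpretation-embedding $i_{\mathrm{pr}}:\mathbf{N}\hookrightarrow\mathbf{M}$, and $\hat{i}_{\mathrm{pr}}$ is restriction of automorphisms of $\mathbf{M}$ to $\mathbf{N}$. Conditions: C1: for every $c\in C$, $\mathrm{dcl}(N\cup\{c\})\supseteq C$. C2: there is a $0$-definable group $\Gamma$ of transformations of $C$ preserving each fibre $\mathrm{pr}^{-1}(n)$, $n\in N$, acting freely and transitively on each fibre, and $\Gamma=\mathrm{Aut}(\mathbf{M}/N)$. C3: the first-order theory of $\mathbf{M}$ is categorical in uncountable cardinals. A set $A\subseteq\mathbf{M}^{eq}$ is a section-imaginary for $i_{\mathrm{pr}}$ (corresponding to a section $\hat g$ of $\hat{i}_{\mathrm{pr}}$) if the identity interpretation of $\mathbf{N}$ in $\mathbf{M}/A$ is an $\mathfrak{M}$-isomorphism $\mathbf{N}\cong\mathbf{M}/A$ (inducing $\hat g$) and (1) $M\subseteq\mathrm{dcl}_{\mathbf{M}^{eq}}(N\cup A)$ and (2) $\mathrm{dcl}_{\mathbf{M}^{eq}}(A)\cap\mathrm{dcl}_{\mathbf{N}^{eq}}(N)=\mathrm{dcl}_{\mathbf{N}^{eq}}(\emptyset)$. Section-imaginaries for $i_{\mathrm{pr}}$ are eliminable if every section-imaginary $A$ for $i_{\mathrm{pr}}$ is of the form $A=\mathrm{dcl}(A_0)$ for some $A_0\subseteq C$.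
   Formalization: The section ĝ is required to be a continuous homomorphism (pointwise-convergence topology on automorphism groups); for arbitrary abstract homomorphisms the equivalence fails, since a discontinuous section may exist when N has no definable point. *)

(* Defs.v *)
From HB Require Import structures.
From mathcomp Require Import all_boot.
From mathcomp Require Import boolp classical_sets functions cardinality.

Set Implicit Arguments.
Unset Strict Implicit.
Unset Printing Implicit Defensive.

Local Open Scope classical_set_scope.
Local Open Scope card_scope.

(* Many-sorted relational structures.  The universe is the disjoint union of  *)
(* the sorts, and srt tells the sorts apart.                                  *)

Record language (S : Type) := Language {
  sym : Type;
  ar : sym -> nat;
  asrt : forall r : sym, 'I_(ar r) -> S }.

Record structure (S : Type) (L : language S) := Structure {
  univ :> Type;
  srt : univ -> S;
  rel_of : forall r : sym L, set ('I_(ar r) -> univ);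
  rel_srt : forall r (t : 'I_(ar r) -> univ), rel_of t -> forall i, srt (t i) = asrt i }.

Arguments rel_of {S L M} r _ : rename.

Definition isomorphic S (L : language S) (M M' : structure L) : Prop :=
  exists f : M -> M', [/\ bijective f,
    forall x, srt (f x) = srt x
    & forall r (t : 'I_(ar r) -> M), rel_of r (f \o t) <-> rel_of r t].

(* First-order formulas whose free variables are indexed by 'I_n; FEx s binds *)
(* the variable ord_max, which ranges over the sort s.                        *)
Inductive formula S (L : language S) : nat -> Type :=
| FBot n : formula L n
| FRel n (r : sym L) (x : 'I_(ar r) -> 'I_n) : formula L n
| FEq n of 'I_n & 'I_n : formula L n
| FImp n of formula L n & formula L n : formula L n
| FEx n of S & formula L n.+1 : formula L n.

Definition env_ext T n (v : 'I_n -> T) (a : T) : 'I_n.+1 -> T :=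
  fun i => if unlift ord_max i is Some j then v j else a.

Definition env0 T : 'I_0 -> T :=
  fun i => False_rect T (notF (ltn_ord i)).

Definition env_cat T m n (t : 'I_m -> T) (u : 'I_n -> T) : 'I_(m + n) -> T :=
  fun i => match fintype.split i with inl j => t j | inr j => u j end.

Fixpoint sat S (L : language S) (M : structure L) n (phi : formula L n) :
    ('I_n -> M) -> Prop :=
  match phi in formula _ n return ('I_n -> M) -> Prop with
  | FBot _ => fun _ => False
  | FRel _ r x => fun v => rel_of r (v \o x)
  | FEq _ x y => fun v => v x = v y
  | FImp _ p q => fun v => sat p v -> sat q v
  | FEx _ s p => fun v => exists a : M, srt a = s /\ sat p (env_ext v a)
  end.

Definition fo_definable S (L : language S) (M : structure L) n
    (R : set ('I_n -> M)) : Prop :=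
  exists phi : formula L n, forall v, R v <-> sat phi v.

Definition models_theory_of S (L : language S) (M M' : structure L) : Prop :=
  forall phi : formula L 0, sat phi (env0 M) -> sat phi (env0 M').

Definition uncountably_categorical S (L : language S) (M : structure L) : Prop :=
  forall M1 M2 : structure L,
    models_theory_of M M1 -> models_theory_of M M2 ->
    ~ countable [set: M1] -> [set: M1] #= [set: M2] -> isomorphic M1 M2.

Definition finitary S (L : language S) (M : structure L) : Prop :=
  exists (I : Type) (D : I -> set M),
    [/\ forall i, finite_set (D i),
        forall i, fo_definable [set t : 'I_1 -> M | D i (t ord0)]
      & \bigcup_i D i = [set: M]].

Record aut S (L : language S) (M : structure L) := Aut {
  aut_fun :> M -> M;
  aut_inv : M -> M;
  aut_funK : cancel aut_fun aut_inv;
  aut_invK : cancel aut_inv aut_fun;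
  aut_srt : forall x, srt (aut_fun x) = srt x;
  aut_rel : forall r (t : 'I_(ar r) -> M), rel_of r (aut_fun \o t) <-> rel_of r t }.

Section AutGroup.
Variables (S : Type) (L : language S) (M : structure L).
Implicit Types s t u : aut M.

Lemma aut_ext s t : s =1 t -> s = t.
Proof.
case: s t => [f f' fK f'K fs fr] [g g' gK g'K gs gr] /= /funext efg.
subst g.
have e : f' = g' by apply/funext => x; rewrite -{1}(g'K x) fK.
subst g'; congr Aut; exact: Prop_irrelevance.
Qed.

HB.instance Definition _ := gen_eqMixin (aut M).
HB.instance Definition _ := gen_choiceMixin (aut M).

Definition aut_one : aut M.
Proof. by exists id id. Defined.

Definition aut_mul s t : aut M.
Proof.
exists (s \o t) (aut_inv t \o aut_inv s).
- exact: can_comp (aut_funK s) (aut_funK t).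
- exact: can_comp (aut_invK t) (aut_invK s).
- by move=> x /=; rewrite !aut_srt.
- by move=> r v; rewrite -(@aut_rel _ _ _ t r v) -(@aut_rel _ _ _ s r (t \o v)).
Defined.

Definition aut_V s : aut M.
Proof.
exists (aut_inv s) s.
- exact: aut_invK.
- exact: aut_funK.
- by move=> x; rewrite -(aut_srt s (aut_inv s x)) aut_invK.
- move=> r v; rewrite -(@aut_rel _ _ _ s r (aut_inv s \o v)).
  suff -> : s \o (aut_inv s \o v) = v by [].
  by apply/funext => i /=; rewrite aut_invK.
Defined.

Fact aut_mulA : associative aut_mul.
Proof. by move=> s t u; apply: aut_ext. Qed.
Fact aut_mul1 : left_id aut_one aut_mul.
Proof. by move=> s; apply: aut_ext. Qed.
Fact aut_mulr1 : right_id aut_one aut_mul.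
Proof. by move=> s; apply: aut_ext. Qed.
Fact aut_mulV : left_inverse aut_one aut_V aut_mul.
Proof. by move=> s; apply: aut_ext => x /=; rewrite aut_funK. Qed.
Fact aut_mulrV : right_inverse aut_one aut_V aut_mul.
Proof. by move=> s; apply: aut_ext => x /=; rewrite aut_invK. Qed.

HB.instance Definition _ := isGroup.Build (aut M)
  aut_mulA aut_mul1 aut_mulr1 aut_mulV aut_mulrV.

End AutGroup.

(* Continuity for the topologies of pointwise convergence, which make the     *)
(* automorphism group of a finitary structure profinite.                      *)
Definition aut_continuous S S' (L : language S) (L' : language S')
    (M : structure L) (M' : structure L') (g : aut M -> aut M') : Prop :=
  forall (s : aut M) (y : M'), exists F : set M, finite_set F /\
    forall t : aut M, (forall x, F x -> t x = s x) -> g t y = g s y.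

(* Imaginaries.  A presort is a candidate D/E; is_eq_sort says that it is a   *)
(* sort of M^eq, and Meq is the set of the elements of M^eq, each of them an  *)
(* E-class together with its sort.                                            *)

Record presort (T : Type) := Presort {
  ps_ar : nat;
  ps_dom : set ('I_ps_ar -> T);
  ps_rel : ('I_ps_ar -> T) -> ('I_ps_ar -> T) -> Prop }.

Arguments ps_dom {T} p _.
Arguments ps_rel {T} p _ _.

Record imag (T : Type) := Imag {
  im_sort : presort T;
  im_cls : set ('I_(ps_ar im_sort) -> T) }.

Arguments im_cls {T} i _.

Definition is_eq_sort S (L : language S) (M : structure L) (P : presort M) : Prop :=
  [/\ exists ss : 'I_(ps_ar P) -> S,
        forall t, ps_dom P t -> forall i, srt (t i) = ss i,
      fo_definable (ps_dom P),
      fo_definable [set w | exists t u, w = env_cat t u /\ ps_rel P t u]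
    & [/\ forall t u, ps_rel P t u -> ps_dom P t /\ ps_dom P u,
          forall t, ps_dom P t -> ps_rel P t t,
          forall t u, ps_rel P t u -> ps_rel P u t
        & forall t u v, ps_rel P t u -> ps_rel P u v -> ps_rel P t v]].

Definition Meq S (L : language S) (M : structure L) : set (imag M) :=
  [set e | is_eq_sort (im_sort e) /\
     exists2 t, ps_dom (im_sort e) t & im_cls e = ps_rel (im_sort e) t].

Definition real S (L : language S) (M : structure L) (m : M) : imag M :=
  @Imag M
    (@Presort M 1 [set t | srt (t ord0) = srt m]
       (fun t u => srt (t ord0) = srt m /\ t = u))
    [set t | t ord0 = m].

Definition imag_map (T T' : Type) (f : T -> T') (e : imag T) : imag T' :=
  @Imag T'
    (@Presort T' (ps_ar (im_sort e))
       [set f \o t | t in ps_dom (im_sort e)]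
       (fun t' u' => exists t u,
          [/\ ps_rel (im_sort e) t u, t' = f \o t & u' = f \o u]))
    [set f \o t | t in im_cls e].

(* The sort of an element of M^eq is invariant under automorphisms, so that s *)
(* fixes the element exactly when it preserves the class.                     *)
Definition fixes S (L : language S) (M : structure L) (s : aut M) (e : imag M) :
    Prop :=
  forall t, im_cls e (s \o t) <-> im_cls e t.

Definition Aut_over S (L : language S) (M : structure L) (A : set (imag M)) :
    set (aut M) :=
  [set s | forall e, A e -> fixes s e].

(* Parameter-free definability in M/A, in the powerful language: a relation   *)
(* is definable iff it is invariant under all automorphisms.                  *)
Definition definable_over S (L : language S) (M : structure L)
    (A : set (imag M)) n (R : set ('I_n -> M)) : Prop :=
  forall s, Aut_over A s -> forall t, R (s \o t) <-> R t.

Definition definable S (L : language S) (M : structure L) n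
    (R : set ('I_n -> M)) : Prop :=
  definable_over set0 R.

(* Definable closure in M^eq, for the same notion of definability; for        *)
(* finitary M it is also the first-order definable closure.                   *)
Definition dcl S (L : language S) (M : structure L) (A : set (imag M)) :
    set (imag M) :=
  [set e | Meq e /\ forall s, Aut_over A s -> fixes s e].

(* The two-sorted structure (C, N, pr): its basic relations are those of C,   *)
(* those of N and the graph of pr.                                            *)

Inductive cover_sort := sortC | sortN.

Definition cover_lang (LC LN : language unit) : language cover_sort :=
  @Language cover_sort (sym LC + sym LN + unit)%type
    (fun r => match r with
       | inl (inl r) => ar r | inl (inr r) => ar r | inr _ => 2 end)
    (fun r => match r with
       | inl (inl _) => fun _ => sortC
       | inl (inr _) => fun _ => sortN
       | inr _ => fun i => if i == ord0 then sortC else sortN end).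

Section Cover.
Variables (LC LN : language unit) (C : structure LC) (N : structure LN).
Variable pr : C -> N.

Definition cover_srt (x : C + N) : cover_sort :=
  match x with inl _ => sortC | inr _ => sortN end.

Definition cover_rel (r : sym (cover_lang LC LN)) :
    set ('I_(ar r) -> (C + N)%type) :=
  match r return set ('I_(@ar _ (cover_lang LC LN) r) -> (C + N)%type) with
  | inl (inl r) => [set inl \o u | u in @rel_of _ _ C r]
  | inl (inr r) => [set inr \o u | u in @rel_of _ _ N r]
  | inr _ => [set t | exists c, t ord0 = inl c /\ t ord_max = inr (pr c)]
  end.

Fact cover_rel_srt r t :
  @cover_rel r t -> forall i, cover_srt (t i) = asrt i.
Proof.
case: r t => [[r|r]|[]] t /=; try by case=> u _ <-.
case=> c [e0 e1] i; case: eqP => [->|ne]; first by rewrite e0.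
suff -> : i = ord_max by rewrite e1.
by apply/val_inj; move: i ne => [[|[|]]] //= h ne; case: ne; apply/val_inj.
Qed.

Definition cover_str : structure (cover_lang LC LN) :=
  Structure cover_rel_srt.

Definition inC (c : C) : cover_str := inl c.
Definition inN (n : N) : cover_str := inr n.

Definition realC : set (imag cover_str) := [set real (inC c) | c in setT].
Definition realN : set (imag cover_str) := [set real (inN n) | n in setT].

(* Automorphisms preserve the sorts, so the second branch is never taken.     *)
Definition autC_fun (s : aut cover_str) (c : C) : C :=
  match s (inC c) with inl c' => c' | inr _ => c end.

Definition autN_fun (s : aut cover_str) (n : N) : N :=
  match s (inN n) with inr n' => n' | inl _ => n end.

Lemma autC_funE (s : aut cover_str) c : s (inC c) = inC (autC_fun s c).
Proof. by rewrite /autC_fun; case: (s (inC c)) (aut_srt s (inC c)). Qed.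

Lemma autN_funE (s : aut cover_str) n : s (inN n) = inN (autN_fun s n).
Proof. by rewrite /autN_fun; case: (s (inN n)) (aut_srt s (inN n)). Qed.

Lemma autN_fun_mul (s t : aut cover_str) n :
  autN_fun (s * t)%g n = autN_fun s (autN_fun t n).
Proof.
have : inN (autN_fun (s * t)%g n) = inN (autN_fun s (autN_fun t n)).
  by rewrite -!autN_funE.
by case.
Qed.

Fact autN_rel (s : aut cover_str) r (t : 'I_(ar r) -> N) :
  rel_of r (autN_fun s \o t) <-> rel_of r t.
Proof.
have lift (u : 'I_(ar r) -> N) :
    @rel_of _ _ cover_str (inl (inr r)) (inN \o u) <-> rel_of r u.
  split=> [[w wr ewu]|ur]; last by exists u.
  suff <- : w = u by [].
  by apply/funext => i; have := congr1 (@^~ i) ewu; case.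
rewrite -!lift -(@aut_rel _ _ _ s (inl (inr r)) (inN \o t)).
suff -> : inN \o (autN_fun s \o t) = s \o (inN \o t) by [].
by apply/funext => i /=; rewrite autN_funE.
Qed.

Definition resN (s : aut cover_str) : aut N.
Proof.
exists (autN_fun s) (autN_fun s^-1%g).
- move=> n; rewrite -autN_fun_mul mulVg //.
- move=> n; rewrite -autN_fun_mul mulgV //.
- by move=> x; case: (srt _); case: (srt _).
- exact: autN_rel.
Defined.

Definition is_cover : Prop :=
  [/\ forall n, exists c, pr c = n,
      forall n, finite_set (pr @^-1` [set n])
    & forall k (R : set ('I_k -> C)),
        @definable _ _ cover_str k [set inC \o t | t in R] ->
        definable [set pr \o t | t in R]].

Definition condC1 : Prop :=
  forall c, realC `<=` dcl (realN `|` [set real (inC c)]).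

(* Automorphisms of M act on transformations of C by conjugation, and a set   *)
(* of transformations is 0-definable iff it is invariant under this action.   *)
Definition definable_transfs (G : set (C -> C)) : Prop :=
  forall (s : aut cover_str) g, G g ->
    G (autC_fun s \o g \o autC_fun s^-1%g).

Definition is_transf_group (G : set (C -> C)) : Prop :=
  [/\ G id, forall g h, G g -> G h -> G (g \o h)
    & forall g, G g -> exists h, [/\ G h, cancel g h & cancel h g]].

Definition condC2 : Prop :=
  exists G : set (C -> C),
    [/\ is_transf_group G, definable_transfs G,
        forall g c, G g -> pr (g c) = pr c,
        forall c c', pr c = pr c' -> exists! g, G g /\ g c = c'
      & G = [set autC_fun s | s in Aut_over realN]].

(* That the identity interpretation of N in M/A is an isomorphism of the      *)
(* category of interpretations: the basic relations of N are definable in     *)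
(* M/A, every relation on N definable in M/A is definable in N, and M is in   *)
(* the definable closure of N in M/A.                                         *)
Definition id_interp_iso (A : set (imag cover_str)) : Prop :=
  [/\ forall r : sym LN,
        definable_over A [set inN \o t | t in @rel_of _ _ N r],
      forall k (R : set ('I_k -> N)),
        definable_over A [set inN \o t | t in R] -> definable R
    & range (@real _ _ cover_str) `<=`
        [set e | Meq e /\ forall s, Aut_over A s -> Aut_over realN s ->
                          fixes s e]].

Definition section_imaginary (A : set (imag cover_str)) : Prop :=
  [/\ A `<=` @Meq _ _ cover_str,
      id_interp_iso A,
      range (@real _ _ cover_str) `<=` dcl (realN `|` A)
    & dcl A `&` [set imag_map inN e | e in dcl (range (@real _ _ N))] =
      [set imag_map inN e | e in @dcl _ _ N set0]].

(* Sets of imaginaries are compared up to interdefinability: a section-       *)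
(* imaginary need not be dcl-closed, and dcl A contains dcl 0, so that A      *)
(* itself could not always be a set of the form dcl A0.                       *)
Definition section_imaginaries_eliminable : Prop :=
  forall A, section_imaginary A ->
    exists A0 : set C, dcl A = dcl [set real (inC c) | c in A0].

(* Morphisms of the profinite groups at hand are continuous homomorphisms.    *)
(* Only a section with closed image can come from a subset of M^eq, and a     *)
(* merely abstract section may exist when no continuous one does.             *)
Definition is_section (g : {multiplicative aut N -> aut cover_str}) : Prop :=
  aut_continuous g /\ forall s, resN (g s) = s.

End Cover.

Arguments inC {LC LN C N} pr c.
Arguments inN {LC LN C N} pr n.
Arguments realC {LC LN C N} pr _.
Arguments realN {LC LN C N} pr _.

(* Main.v *)
(* Aut(M) is compact because M is a union of finite 0-definable sets.         *)
(* If a continuous section exists, its image H is a closed complement of      *)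
(* Aut(M/N), hence the stabiliser of the imaginaries it fixes.  These form a  *)
(* section-imaginary, so elimination gives H = Aut(M/A0) with A0 a subset of  *)
(* C; as H is proper, A0 has an element c, and pr c is fixed by H, that is,   *)
(* by Aut(N).  Conversely, if n is a definable point and pr c = n, then       *)
(* restriction to N is a bijection from the stabiliser of c onto Aut(N):      *)
(* injective by C1, surjective by C2 and compactness.                         *)

Require Import Defs.
From HB Require Import structures.
From mathcomp Require Import all_boot finmap.
From mathcomp Require Import boolp classical_sets functions cardinality filter.

Set Implicit Arguments.
Unset Strict Implicit.
Unset Printing Implicit Defensive.

Local Open Scope classical_set_scope.

(** Everything is read off the group Aut(M) with pointwise convergence. As M is a union of finite
    definable sets, any family of elementary maps on its finite subsets has a limit automorphism
    ([aut_limit]). Hence Aut(M) is compact ([aut_compact]) and tuples of the same type are conjugate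
    ([elementary_aut]), so invariant relations on finite sets are first-order definable
    ([fo_definable_invariant]). Orbits of finite tuples thus become imaginaries, and a closed
    subgroup is the stabiliser of the imaginaries that it fixes ([Aut_over_closed_subgroup]).

    Given a continuous section g, its image H is a closed complement of the kernel Aut(M/N) of
    restriction, so the imaginaries fixed by H form a section-imaginary. Elimination makes H the
    pointwise stabiliser of some A0 in C. This A0 is nonempty, since otherwise H = Aut(M) would meet
    the non-trivial kernel. A point c of A0 is fixed by H, which maps onto Aut(N), so pr c is
    definable.

    Given a definable point n and c above it, the stabiliser of c is a complement of the kernel: C1
    gives uniqueness of lifts fixing c, while [resN_surjective] and C2 give their existence.
    Compactness makes this choice of lifts continuous. *)

(** * Finite sets and the selection principle *)

Lemma finite_set_enum T (A : set T) :
  finite_set A -> exists k (x : 'I_k -> T), A = range x.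
Proof.
elim/Pchoice: T => T in A * => /finite_seqP[s ->].
exists (size s), (tnth (in_tuple s)); apply/seteqP; split=> x /=.
  by case/seq_tnthP => i ->; exists i.
by move=> [i _ <-]; exact: mem_tnth.
Qed.

Lemma finite_range_ord k T (x : 'I_k -> T) : finite_set (range x).
Proof. exact: finite_image. Qed.

Lemma finite_inj_onto T (A : set T) (f : T -> T) :
  finite_set A -> (forall x, A x -> A (f x)) -> injective f ->
  forall y, A y -> exists2 x, A x & f x = y.
Proof.
elim/Pchoice: T => T in A f * => /finite_fsetP[X ->] /= fX fI y yX.
suff : y \in [fset f x | x in X]%fset by case/imfsetP => x /= xX ->; exists x.
suff -> : [fset f x | x in X]%fset = X by [].
apply/eqP; rewrite eqEfcard card_imfset //= leqnn andbT.
by apply/fsubsetP => _ /imfsetP[x /= xX ->]; exact: fX.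
Qed.

(* Rado's selection lemma, by taking the limit along an ultrafilter on the    *)
(* directed set of the finite subsets of T.                                   *)
Lemma rado_selection T T' (B : T -> set T') (f : set T -> T -> T') :
  (forall x, finite_set (B x)) ->
  (forall F, finite_set F -> forall x, F x -> B x (f F x)) ->
  exists g : T -> T', forall F, finite_set F ->
    exists F', [/\ finite_set F', F `<=` F' & forall x, F x -> g x = f F' x].
Proof.
move=> finB fB.
pose U0 : set_system (set T) := [set X | exists2 F, finite_set F &
  forall F', finite_set F' -> F `<=` F' -> X F'].
have U0P : ProperFilter U0.
  apply: Build_ProperFilter_ex.
    by move=> X [F finF FX]; exists F; exact: FX.
  split; first by exists set0.
  - move=> X Y [F finF FX] [G finG GY]; exists (F `|` G).
      by rewrite finite_setU.
    move=> F' finF'; rewrite subUset => -[FF' GF'].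
    by split; [exact: FX|exact: GY].
  - by move=> X Y XY [F finF FX]; exists F => // F' finF' FF'; exact/XY/FX.
have [U [ultraU U0U]] := ultraFilterLemma U0P.
have above F : finite_set F -> U [set F' | finite_set F' /\ F `<=` F'].
  by move=> finF; apply: U0U; exists F.
(* The values at [x] eventually lie in a finite set, so the ultrafilter concentrates on one of
   them. *)
have lim x : exists y, U [set F | f F x = y].
  apply: contrapT => /forallNP noy.
  have [k [b Bb]] := finite_set_enum (finB x).
  have Ub : U [set F | forall i, f F x <> b i].
    apply: (@filter_forall _ _ (fun i => [set F | f F x <> b i]) U _) => i.
    by have [/noy|] := in_ultra_setVsetC [set F | f F x = b i] ultraU.
  have [F [Fb [finF xF]]] := filter_ex (filterI Ub (above _ (finite_set1 x))).
  have := fB _ finF x (xF x erefl); rewrite Bb => -[i _ e].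
  exact: (Fb i).
have [g gP] := choice lim; exists g => F finF.
have [k [x Fx]] := finite_set_enum finF.
have Ug : U [set F' | forall i, f F' (x i) = g (x i)].
  apply: (@filter_forall _ _ (fun i => [set F' | f F' (x i) = g (x i)]) U _).
  by move=> i; exact: gP.
have [F' [gF' [finF' FF']]] := filter_ex (filterI Ug (above _ finF)).
by exists F'; split=> // y; rewrite Fx => -[i _ <-].
Qed.

Lemma env_ext_max T n (v : 'I_n -> T) a : env_ext v a ord_max = a.
Proof. by rewrite /env_ext unlift_none. Qed.

Lemma env_ext_lift T n (v : 'I_n -> T) a i : env_ext v a (lift ord_max i) = v i.
Proof. by rewrite /env_ext liftK. Qed.

Lemma comp_env_ext T T' (f : T -> T') n (v : 'I_n -> T) a :
  f \o env_ext v a = env_ext (f \o v) (f a).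
Proof. by apply/funext => i /=; rewrite /env_ext; case: unlift. Qed.

Lemma env_cat_lshift T m n (t : 'I_m -> T) (u : 'I_n -> T) i :
  env_cat t u (lshift n i) = t i.
Proof. by rewrite /env_cat -[lshift n i]/(unsplit (inl _ i)) unsplitK. Qed.

Lemma env_cat_rshift T m n (t : 'I_m -> T) (u : 'I_n -> T) i :
  env_cat t u (rshift m i) = u i.
Proof. by rewrite /env_cat -[rshift m i]/(unsplit (inr _ i)) unsplitK. Qed.

Lemma comp_env_cat T T' (f : T -> T') m n (t : 'I_m -> T) (u : 'I_n -> T) :
  f \o env_cat t u = env_cat (f \o t) (f \o u).
Proof. by apply/funext => i /=; rewrite /env_cat; case: fintype.split. Qed.

(** * First-order definability *)

Section Definability.
Variables (S : Type) (L : language S).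

(** Under a quantifier the bound variable [ord_max] stays last and the free ones are shifted past
    it. *)
Fixpoint rename n (phi : formula L n) :
    forall m, ('I_n -> 'I_m) -> formula L m :=
  match phi in formula _ n return forall m, ('I_n -> 'I_m) -> formula L m with
  | FBot _ => fun m _ => FBot L m
  | FRel _ r x => fun m f => FRel (f \o x)
  | FEq _ x y => fun m f => FEq L (f x) (f y)
  | FImp _ p q => fun m f => FImp (rename p f) (rename q f)
  | FEx _ s p => fun m f =>
      FEx s (rename p (env_ext (lift ord_max \o f) ord_max))
  end.

Variable M : structure L.

Lemma sat_rename n (phi : formula L n) m (f : 'I_n -> 'I_m) (v : 'I_m -> M) :
  sat (rename phi f) v <-> sat phi (v \o f).
Proof.
elim: phi m f v => {n} //= [n p IHp q IHq|n s p IHp] m f v.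
  by rewrite IHp IHq.
suff e a : env_ext v a \o env_ext (lift ord_max \o f) ord_max = env_ext (v \o f) a.
  by split=> -[a [? Ha]]; exists a; split=> //; move: Ha; rewrite IHp e.
rewrite comp_env_ext env_ext_max; congr env_ext.
by apply/funext => i /=; rewrite env_ext_lift.
Qed.

Lemma sat_aut (s : aut M) n (phi : formula L n) (v : 'I_n -> M) :
  sat phi (s \o v) <-> sat phi v.
Proof.
elim: phi v => {n} //= [n r x|n x y|n p IHp q IHq|n u p IHp] v.
- exact: (aut_rel s (v \o x)).
- by split=> [/(can_inj (aut_funK s))|->].
- by rewrite IHp IHq.
- split=> -[a [<- Ha]].
    exists (aut_inv s a); split; first by rewrite -(aut_srt s) aut_invK.
    by rewrite -IHp comp_env_ext aut_invK.
  by exists (s a); rewrite aut_srt; split=> //; rewrite -comp_env_ext IHp.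
Qed.

Lemma fo_definable_ext n (P Q : set ('I_n -> M)) :
  (forall v, P v <-> Q v) -> fo_definable P -> fo_definable Q.
Proof. by move=> PQ [phi phiP]; exists phi => v; rewrite -PQ. Qed.

Lemma fo_definableC n (P : set ('I_n -> M)) :
  fo_definable P -> fo_definable (~` P).
Proof.
by case=> phi phiP; exists (FImp phi (FBot L n)) => v /=; rewrite -phiP.
Qed.

Lemma fo_definableI n (P Q : set ('I_n -> M)) :
  fo_definable P -> fo_definable Q -> fo_definable (P `&` Q).
Proof.
move=> [phi phiP] [psi psiQ].
exists (FImp (FImp phi (FImp psi (FBot L n))) (FBot L n)) => v /=.
rewrite -phiP -psiQ; split=> [[? ?]|nPQ]; first exact.
by split; apply: contrapT => ?; apply: nPQ.
Qed.

Lemma fo_definable_preimage m n (P : set ('I_m -> M)) (f : 'I_m -> 'I_n) :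
  fo_definable P -> fo_definable [set v : 'I_n -> M | P (v \o f)].
Proof. by case=> phi phiP; exists (rename phi f) => v /=; rewrite sat_rename -phiP. Qed.

Lemma fo_definableT n : fo_definable [set: 'I_n -> M].
Proof. by exists (FImp (FBot L n) (FBot L n)) => v; split=> // _ /=. Qed.

Lemma fo_definable_exists n s (P : set ('I_n.+1 -> M)) :
  fo_definable P ->
  fo_definable [set v | exists a, srt a = s /\ P (env_ext v a)].
Proof.
case=> phi phiP; exists (FEx s phi) => v /=.
by split=> -[a [? Pa]]; exists a; split=> //; exact/phiP.
Qed.

Lemma fo_definable_srt n (i : 'I_n) s :
  fo_definable [set v : 'I_n -> M | srt (v i) = s].
Proof.
exists (FEx s (FEq L (lift ord_max i) ord_max)) => v /=.
split=> [<-|[a]]; last by rewrite env_ext_lift env_ext_max => -[<- ->].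
by exists (v i); rewrite env_ext_lift env_ext_max.
Qed.

Lemma fo_definable_forall_ord n k (P : 'I_k -> set ('I_n -> M)) :
  (forall i, fo_definable (P i)) -> fo_definable [set v | forall i, P i v].
Proof.
elim: k P => [|k IHk] P fP.
  by apply: (fo_definable_ext _ (fo_definableT n)) => v; split=> // _ [].
have fP' := fo_definableI (fP ord_max) (IHk _ (fun i => fP (lift ord_max i))).
apply: (fo_definable_ext _ fP') => v; split=> [[Pm Pl] i|Pv]; last by split.
by have [j ->|->] := unliftP ord_max i; [exact: Pl|].
Qed.

Lemma fo_definable_bigcap I (A : set I) n (P : I -> set ('I_n -> M)) :
  finite_set A -> (forall i, A i -> fo_definable (P i)) ->
  fo_definable (\bigcap_(i in A) P i).
Proof.
move=> /finite_set_enum[k [x ->]] fP.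
have fPx : fo_definable [set v | forall i, P (x i) v].
  by apply: fo_definable_forall_ord => i; apply: fP; exists i.
apply: (fo_definable_ext _ fPx) => v; split=> [Pv _ [i _ <-]|Pv i]; first exact: Pv.
by apply: Pv; exists i.
Qed.

Lemma fo_definable_bigcup I (A : set I) n (P : I -> set ('I_n -> M)) :
  finite_set A -> (forall i, A i -> fo_definable (P i)) ->
  fo_definable (\bigcup_(i in A) P i).
Proof.
move=> finA fP; rewrite -[X in fo_definable X]setCK setC_bigcup.
by apply/fo_definableC/fo_definable_bigcap => // i Ai; exact/fo_definableC/fP.
Qed.

(** * Types of tuples, limits and homogeneity *)

(** This is equality of complete types: one implication suffices because formulas are closed under
    negation. *)
Definition elementary n (v w : 'I_n -> M) : Prop :=
  forall phi : formula L n, sat phi v -> sat phi w.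

Lemma elementary_iff n (v w : 'I_n -> M) (phi : formula L n) :
  elementary v w -> sat phi v <-> sat phi w.
Proof.
move=> vw; split; first exact: vw.
by move=> phiw; apply: contrapT => /(vw (FImp phi (FBot L n))); exact.
Qed.

Lemma elementary_comp m n (v w : 'I_n -> M) (f : 'I_m -> 'I_n) :
  elementary v w -> elementary (v \o f) (w \o f).
Proof. by move=> vw phi; rewrite -2!(sat_rename phi f); exact: vw. Qed.

Lemma elementary_definable n (v w : 'I_n -> M) (P : set ('I_n -> M)) :
  elementary v w -> fo_definable P -> P v -> P w.
Proof. by move=> vw [phi phiP] /phiP/vw/phiP. Qed.

Definition elementary_on (F : set M) (f : M -> M) : Prop :=
  forall n (t : 'I_n -> M), (forall i, F (t i)) -> elementary t (f \o t).

Hypothesis finM : finitary M.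

(* Finitary structures are homogeneous: a limit of finite partial elementary  *)
(* maps is a permutation of each of the finite definable pieces.              *)
Lemma aut_limit (f : set M -> M -> M) :
  (forall F, finite_set F -> elementary_on F (f F)) ->
  exists s : aut M, forall F, finite_set F ->
    exists F', [/\ finite_set F', F `<=` F' & forall x, F x -> s x = f F' x].
Proof.
move=> fE; have [I [D [finD foD coverD]]] := finM.
have /choice[d dP] (x : M) : exists i, D i x.
  by have : [set: M] x by []; rewrite -coverD => -[i _]; exists i.
have fD i F x : finite_set F -> F x -> D i x -> D i (f F x).
  move=> finF Fx.
  exact: (elementary_definable (fE F finF 1 (fun=> x) (fun=> Fx)) (foD i)).
have [|g gP] := @rado_selection M M (fun x => D (d x)) f (fun x => finD (d x)).
  by move=> F finF x Fx; exact: fD.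
(* A formula sees only finitely many points, on which [g] agrees with a single [f F']. *)
have gE : forall n (t : 'I_n -> M), elementary t (g \o t).
  move=> n t; have [F' [finF' tF' gF']] := gP _ (finite_range_ord t).
  suff -> : g \o t = f F' \o t by apply: fE => // i; apply: tF'; exists i.
  by apply/funext => i /=; apply: gF'; exists i.
have gD i x : D i x -> D i (g x).
  exact: (elementary_definable (gE 1 (fun=> x)) (foD i)).
have gI : injective g.
  move=> x y exy.
  have := elementary_iff (FEq L ord0 ord_max)
    (gE 2 (fun i => if i == ord0 then x else y)).
  by move=> /= [_]; exact.
have gS y : exists x, g x = y.
  by have [x _ <-] := finite_inj_onto (finD _) (gD _) gI (dP y); exists x.
have /choice[h hK] := gS.
have gK : cancel g h by move=> x; apply: gI.
have gsrt x : srt (g x) = srt x.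
  by apply: (elementary_definable (gE 1 (fun=> x)) (fo_definable_srt ord0 (srt x))).
have grel r (t : 'I_(ar r) -> M) : rel_of r (g \o t) <-> rel_of r t.
  by have := elementary_iff (FRel id) (gE _ t) => /= ->.
by exists (Aut gK hK gsrt grel).
Qed.

(** Compactness: a net of automorphisms indexed by the finite subsets of M has a cluster point. *)
Lemma aut_compact (t : set M -> aut M) :
  exists s : aut M, forall F, finite_set F ->
    exists F', [/\ finite_set F', F `<=` F' & forall x, F x -> s x = t F' x].
Proof. by apply: (@aut_limit (fun F => t F)) => F _ n v _ phi /(sat_aut (t F)). Qed.

(** The point [a] lies in a finite definable piece. If every [b] in that piece were refuted by some
    formula true of [a], the finite conjunction of these formulas would be realised over [v] but not
    over [w]. *)
Lemma elementary_extend1 n (v w : 'I_n -> M) a :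
  elementary v w -> exists b, elementary (env_ext v a) (env_ext w b).
Proof.
move=> vw; have [I [D [finD foD coverD]]] := finM.
have [i _ Dia] : (\bigcup_i D i) a by rewrite coverD.
apply: contrapT => /forallNP nvw.
have /choice[phi phiP] (b : M) : exists phi : formula L n.+1,
    sat phi (env_ext v a) /\ ~ sat phi (env_ext w b).
  have /existsNP[phi /not_implyP[? ?]] := nvw b; by exists phi.
pose P := [set u : 'I_n.+1 -> M | D i (u ord_max)] `&`
          \bigcap_(b in D i) [set u | sat (phi b) u].
have foP : fo_definable P.
  apply: fo_definableI.
    exact: (fo_definable_preimage (fun=> ord_max) (foD i)).
  by apply: fo_definable_bigcap => // b _; exists (phi b).
have [|b [_ []]] := elementary_definable vw (fo_definable_exists (srt a) foP).
  exists a; split=> //; split; first by rewrite /= env_ext_max.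
  by move=> b _; exact: (phiP b).1.
by rewrite /= env_ext_max => Db /(_ b Db); exact: (phiP b).2.
Qed.

Lemma elementary_extend k (x : 'I_k -> M) n (v w : 'I_n -> M) :
  elementary v w -> exists m (v' w' : 'I_m -> M) (f : 'I_n -> 'I_m),
    [/\ elementary v' w', v = v' \o f, w = w' \o f & range x `<=` range v'].
Proof.
move=> vw; elim: k x => [|k IHk] x.
  by exists n, v, w, id; split=> // t [[]].
have [m [v' [w' [f [vw' ev ew xv]]]]] := IHk (x \o lift ord_max).
have [b vwb] := elementary_extend1 (x ord_max) vw'.
exists m.+1, (env_ext v' (x ord_max)), (env_ext w' b), (lift ord_max \o f).
split=> //.
- by apply/funext => i; rewrite ev /= env_ext_lift.
- by apply/funext => i; rewrite ew /= env_ext_lift.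
- move=> _ [i _ <-]; have [j ->|->] := unliftP ord_max i.
    have [|l _ <-] := xv (x (lift ord_max j)); first by exists j.
    by exists (lift ord_max l) => //; rewrite env_ext_lift.
  by exists ord_max => //; rewrite env_ext_max.
Qed.

(** Extend the map from [v] to [w] to an elementary map on each finite set, then pass to the
    limit. *)
Lemma elementary_aut n (v w : 'I_n -> M) :
  elementary v w -> exists s : aut M, s \o v = w.
Proof.
move=> vw.
have /choice[f fP] (F : set M) : exists f : M -> M, finite_set F ->
    elementary_on F f /\ f \o v = w.
  have [/finite_set_enum[k [x ->]]|] := pselect (finite_set F); last by exists id.
  have [m [v' [w' [h [vw' ev ew xv]]]]] := elementary_extend x vw.
  (* Equalities within [v'] persist in [w'], so [v' i] determines [w' i]; off the range of [v'] the
     value is arbitrary. *)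
  have /choice[f fP] (y : M) : exists z, forall i, v' i = y -> w' i = z.
    have [[j <-]|nex] := pselect (exists j, v' j = y).
      by exists (w' j) => i eij; exact: (vw' (FEq L i j)).
    by exists y => i eiy; case: nex; exists i.
  have fv : f \o v' = w' by apply/funext => i /=; rewrite -(fP _ i erefl).
  exists f => _; split; last by rewrite ev ew compA fv.
  move=> l t tx; have /choice[g gP] (i : 'I_l) : exists j, v' j = t i.
    by have [j _ <-] := xv _ (tx i); exists j.
  have -> : t = v' \o g by apply/funext => i /=; rewrite gP.
  by rewrite compA fv; exact: elementary_comp.
have [s sP] := aut_limit (fun F finF => (fP F finF).1); exists s.
have [F [finF vF sF]] := sP _ (finite_range_ord v).
rewrite -(fP F finF).2; apply/funext => i /=; apply: sF.
by exists i.
Qed.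

(** * Invariant relations on finite sets *)

Lemma invariant_cover (F : set M) : finite_set F -> exists2 B : set M,
  finite_set B & [/\ fo_definable [set t : 'I_1 -> M | B (t ord0)], F `<=` B
    & forall (s : aut M) x, B x -> B (s x)].
Proof.
move=> finF; have [I [D [finD foD coverD]]] := finM.
have /choice[d dP] (x : M) : exists i, D i x.
  by have : [set: M] x by []; rewrite -coverD => -[i _]; exists i.
have foB : fo_definable
    [set t : 'I_1 -> M | (\bigcup_(x in F) D (d x)) (t ord0)].
  exact: (fo_definable_bigcup (P := fun x => [set t | D (d x) (t ord0)])).
exists (\bigcup_(x in F) D (d x)); first exact: bigcup_finite.
split=> // [x Fx|s x]; first by exists x.
move: foB => [phi phiP] /(phiP (fun=> x))/(sat_aut s) Bsx.
exact/(phiP (s \o fun=> x)).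
Qed.

Lemma finite_set_tuples k (B : set M) :
  finite_set B -> finite_set [set t : 'I_k -> M | forall i, B (t i)].
Proof.
elim: k => [|k IHk] finB.
  apply: (@sub_finite_set _ _ [set env0 M]) => // t _ /=.
  by apply/funext => -[].
apply: (sub_finite_set _ (finite_image2 (@env_ext M k) (IHk finB) finB)) => t Bt.
exists (t \o lift ord_max); first by move=> i; exact: Bt.
exists (t ord_max); first exact: Bt.
apply/funext => i; have [j ->|->] := unliftP ord_max i.
  by rewrite env_ext_lift.
by rewrite env_ext_max.
Qed.

(** A tuple in [P] and one outside are not conjugate, so by homogeneity a formula separates them.
    Inside a finite definable set of tuples, finitely many such formulas combine to define [P]. *)
Lemma fo_definable_invariant k (B : set M) (P : set ('I_k -> M)) :
  finite_set B -> (forall t, P t -> forall i, B (t i)) ->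
  (forall (s : aut M) t, P t -> P (s \o t)) -> fo_definable P.
Proof.
move=> finB PB Pinv; have [B' finB' [foB' BB' _]] := invariant_cover finB.
pose Q := [set t : 'I_k -> M | forall i, B' (t i)].
have finQ : finite_set Q by exact: finite_set_tuples.
have foQ : fo_definable Q.
  by apply: fo_definable_forall_ord => i; exact: (fo_definable_preimage (fun=> i) foB').
have PQ : P `<=` Q by move=> t Pt i; exact/BB'/PB.
have /choice[phi phiP] (vw : ('I_k -> M) * ('I_k -> M)) :
    exists phi : formula L k, P vw.1 -> ~ P vw.2 -> sat phi vw.1 /\ ~ sat phi vw.2.
  have [[Pv nPw]|nP] := pselect (P vw.1 /\ ~ P vw.2); last first.
    by exists (FBot L k) => Pv nPw; case: nP.
  have /existsNP[phi /not_implyP[? ?]] : ~ elementary vw.1 vw.2.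
    by move=> /elementary_aut[s es]; apply: nPw; rewrite -es; exact: Pinv.
  by exists phi.
have foR : fo_definable (Q `&` \bigcup_(v in P) \bigcap_(w in Q `\` P)
    [set u | sat (phi (v, w)) u]).
  apply: fo_definableI => //; apply: fo_definable_bigcup.
    exact: sub_finite_set finQ.
  move=> v _; apply: fo_definable_bigcap; last by move=> w _; exists (phi (v, w)).
  exact: finite_setD.
apply: (fo_definable_ext _ foR) => u; split=> [[Qu [v Pv phiu]]|Pu].
  apply: contrapT => nPu.
  by have [_] := phiP (v, u) Pv nPu; apply; exact: phiu.
split; first exact: PQ.
by exists u => // w [_ nPw]; exact: (phiP (u, w) Pu nPw).1.
Qed.

End Definability.

(** * Imaginaries and closed subgroups *)

Section Imaginaries.
Variables (S : Type) (L : language S) (M : structure L).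

Lemma Meq_real (m : M) : Meq (real m).
Proof.
split; last by exists (fun=> m) => //; apply/funext => t; apply/propext;
  split=> [tm|[_ <-]] //; split=> //; apply/funext => i; rewrite (ord1 i).
split.
- by exists (fun=> srt m) => t srtt i; rewrite (ord1 i).
- exact: fo_definable_srt.
- have fo : fo_definable ([set w : 'I_(1 + 1) -> M | srt (w (lshift 1 ord0)) = srt m] `&`
      [set w | w (lshift 1 ord0) = w (rshift 1 ord0)]).
    apply: fo_definableI; first exact: fo_definable_srt.
    by exists (FEq L (lshift 1 ord0) (rshift 1 ord0)).
  apply: (fo_definable_ext _ fo) => w; split=> [[ws we]|[t [u [-> [ts <-]]]]].
    exists (w \o @lshift 1 1), (w \o @rshift 1 1); split.
      apply/funext => i; rewrite /env_cat; case: split_ordP => j -> //.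
    by split=> //; apply/funext => i; rewrite (ord1 i).
  by split; rewrite /= !env_cat_lshift ?env_cat_rshift.
- split=> [t u [ts <-]|t|t u [ts <-]|t u v [ts <-]] //.
Qed.

Lemma fixes_real (s : aut M) m : fixes s (real m) <-> s m = m.
Proof.
split=> [/(_ (fun=> m)) [_]|sm t /=]; first exact.
by split=> [|->] //; rewrite -{1}sm => /(can_inj (aut_funK s)).
Qed.

(** Interdefinable sets of imaginaries therefore have the same stabiliser, which is how elimination
    is exploited. *)
Lemma Aut_over_dcl (A : set (imag M)) :
  A `<=` @Meq _ _ M -> Aut_over (dcl A) = Aut_over A.
Proof.
move=> AMeq; apply/seteqP; split=> s sA e Ae; last exact: Ae.2.
by apply: sA; split=> [|t]; [exact: AMeq|exact].
Qed.

Hypothesis finM : finitary M.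
Variable H : set (aut M).
Hypotheses (H1 : H 1%g) (HM : forall s t, H s -> H t -> H (s * t)%g).
Hypothesis HV : forall s, H s -> H s^-1%g.

(* The class of m is the H-orbit of m when the range of m is invariant.       *)
Definition orbit_sort k (m : 'I_k -> M) : presort M :=
  @Presort M k [set t | exists s : aut M, t = s \o m]
    (fun t u => exists (s h : aut M), [/\ H h, t = s \o m & u = s \o (h \o m)]).

Definition orbit_imag k (m : 'I_k -> M) : imag M :=
  @Imag M (orbit_sort m) (ps_rel (orbit_sort m) m).

Lemma autVK (s : aut M) n (t : 'I_n -> M) : s^-1%g \o (s \o t) = t.
Proof. by apply/funext => i /=; exact: aut_funK. Qed.

Lemma autKV (s : aut M) n (t : 'I_n -> M) : s \o (s^-1%g \o t) = t.
Proof. by apply/funext => i /=; exact: aut_invK. Qed.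

Section Orbit.
Variables (k : nat) (m : 'I_k -> M).
Hypothesis mI : forall (s : aut M) i, range m (s (m i)).

(** The tuple [h \o m] only takes values among the entries of [m], by invariance of the range. *)
Let fix_range (s : aut M) : s \o m = m ->
  forall h : aut M, s \o (h \o m) = h \o m.
Proof.
move=> sm h; apply/funext => i /=; have [j _ <-] := mI h i.
by have := congr1 (@^~ j) sm.
Qed.

(** The domain and the equivalence are invariant relations on the finite range of [m], hence
    first-order definable. *)
Lemma Meq_orbit : Meq (orbit_imag m).
Proof.
split; last by exists m => //=; exists 1%g.
split.
- by exists (@srt _ _ M \o m) => _ /= [s ->] i /=; rewrite aut_srt.
- apply: (fo_definable_invariant finM (finite_range_ord m)).
    by move=> _ [s ->] i; exact: mI.
  by move=> s _ [t ->]; exists (s * t)%g.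
- apply: (fo_definable_invariant finM (finite_range_ord m)).
    move=> _ [t [u [-> [s [h [_ -> ->]]]]]] i.
    rewrite /env_cat; case: split_ordP => j _ /=; first exact: mI.
    exact: (mI (s * h)%g).
  move=> a _ [t [u [-> [s [h [Hh -> ->]]]]]].
  exists (a \o (s \o m)), (a \o (s \o (h \o m))); rewrite comp_env_cat.
  by split=> //; exists (a * s)%g, h.
- split=> /=.
  + by move=> t u [s [h [Hh -> ->]]]; split; [exists s|exists (s * h)%g].
  + by move=> _ [s ->]; exists s, 1%g.
  + move=> t u [s [h [Hh -> ->]]]; exists (s * h)%g, h^-1%g.
    split=> //; first exact: HV.
    by rewrite -[RHS]/(s \o (h \o (h^-1%g \o m))) autKV.
  + move=> t u v [s [h [Hh -> es]]] [s' [h' [Hh' es' ->]]].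
    exists s, (h * h')%g; split=> //; first exact: HM.
    (* Both [s'] and [s * h] represent the middle tuple, so they agree on [m] and hence on
       [h' \o m]. *)
    have fixm : ((s * h)^-1 * s')%g \o m = m.
      rewrite -[LHS]/((s * h)^-1%g \o (s' \o m)) -es' es.
      by rewrite -[X in _ \o X]/((s * h)%g \o m) autVK.
    have := fix_range fixm h'.
    rewrite -[LHS]/((s * h)^-1%g \o (s' \o (h' \o m))) => e.
    by rewrite -[RHS]/((s * h)%g \o (h' \o m)) -[in RHS]e autKV.
Qed.

Lemma orbit_clsE t :
  im_cls (orbit_imag m) t <-> exists2 h, H h & t = h \o m.
Proof.
split=> /= [[s [h [Hh /esym em ->]]]|[h Hh ->]]; last by exists 1%g, h.
by exists h => //; exact: fix_range.
Qed.

Lemma fixes_orbit h : H h -> fixes h (orbit_imag m).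
Proof.
move=> Hh t; rewrite !orbit_clsE; split=> -[h' Hh'].
  move=> e; exists (h^-1 * h')%g; first exact/HM/Hh'/HV.
  by rewrite -[RHS]/(h^-1%g \o (h' \o m)) -e autVK.
by move=> ->; exists (h * h')%g => //; exact: HM.
Qed.

End Orbit.

(** If [s] fixes every imaginary fixed by H, it preserves the H-orbit of any tuple enumerating a
    finite invariant set. So [s] agrees with some element of H on each finite set, and closedness
    concludes. *)
Lemma Aut_over_closed_subgroup :
  (forall s : aut M, (forall F, finite_set F ->
     exists2 h, H h & forall x, F x -> s x = h x) -> H s) ->
  Aut_over [set e | Meq e /\ forall h, H h -> fixes h e] = H.
Proof.
move=> Hclosed; apply/seteqP; split=> s; last by move=> Hs e [_]; exact.
move=> sH; apply: Hclosed => F finF.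
have [B finB [_ FB Binv]] := invariant_cover finM finF.
have [k [m Bm]] := finite_set_enum finB.
have mI (t : aut M) i : range m (t (m i)).
  by rewrite -Bm; apply: Binv; rewrite Bm; exists i.
have sm := sH _ (conj (Meq_orbit mI) (fixes_orbit mI)).
have [|h Hh ehm] := (orbit_clsE mI (s \o m)).1.
  by apply/sm/orbit_clsE => //; exists 1%g.
exists h => // x /FB; rewrite Bm => -[i _ <-].
by have := congr1 (@^~ i) ehm.
Qed.

End Imaginaries.

(** * The base N inside M, and restriction to N *)

Section CoverStructure.
Variables (LC LN : language unit) (C : structure LC) (N : structure LN).
Variable pr : C -> N.
Local Notation M := (cover_str pr).

Fixpoint base_formula n (phi : formula LN n) : formula (cover_lang LC LN) n :=
  match phi in formula _ n return formula (cover_lang LC LN) n with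
  | FBot n => FBot _ n
  | FRel n r x => @FRel _ (cover_lang LC LN) n (inl (inr r)) x
  | FEq n x y => FEq _ x y
  | FImp _ p q => FImp (base_formula p) (base_formula q)
  | FEx _ _ p => FEx sortN (base_formula p)
  end.

Lemma sat_base_formula n (phi : formula LN n) (t : 'I_n -> N) :
  sat phi t <-> sat (M := M) (base_formula phi) (inN pr \o t).
Proof.
elim: phi t => {n} //= [n r x|n x y|n p IHp q IHq|n u p IHp] t.
- split=> [tr|[w wr ew]]; first by exists (t \o x).
  suff <- : w = t \o x by [].
  by apply/funext => i; have [] := congr1 (@^~ i) ew.
- by split=> [->|[]].
- by rewrite IHp IHq.
- split=> [[a [_ /IHp]]|[[c|a] [ea Ha]] //].
    by rewrite comp_env_ext => Ha; exists (inN pr a).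
  exists a; split; first by case: (srt a); case: u.
  by apply/IHp; rewrite comp_env_ext.
Qed.

Lemma fo_definable_inN n (P : set ('I_n -> N)) :
  fo_definable P -> @fo_definable _ _ M n [set inN pr \o t | t in P].
Proof.
move=> [phi phiP].
have fo : @fo_definable _ _ M n ([set v | forall i, srt (v i) = sortN] `&`
    [set v | sat (base_formula phi) v]).
  apply: fo_definableI; last by exists (base_formula phi).
  by apply: fo_definable_forall_ord => i; exact: fo_definable_srt.
apply: (fo_definable_ext _ fo) => v; split=> [[vN phiv]|[t Pt <-]]; last first.
  by split=> //; apply/sat_base_formula/phiP.
have /choice[t tv] i : exists y, inN pr y = v i.
  by have := vN i; case: (v i) => // y _; exists y.
have vE : inN pr \o t = v by apply/funext.
by exists t => //; apply/phiP/sat_base_formula; rewrite vE.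
Qed.

Lemma inN_comp_inj n : injective (fun t : 'I_n -> N => inN pr \o t).
Proof.
by move=> t u e; apply/funext => i; have [] := congr1 (@^~ i) e.
Qed.

Lemma Meq_imag_map (e : imag N) : Meq e -> @Meq _ _ M (imag_map (inN pr) e).
Proof.
case: e => [[k D R] cl] /= [[/= _ foD foR [RD Rr Rs Rt]] [/= t Dt clt]].
split; last first.
  exists (inN pr \o t); first by exists t.
  rewrite /= clt; apply/seteqP; split=> [_ [u Ru <-]|_ [t' [u [Ru /inN_comp_inj -> ->]]]].
    by exists t, u.
  by exists u.
split=> /=.
- by exists (fun=> sortN) => _ [u _ <-].
- exact: fo_definable_inN.
- apply: (fo_definable_ext _ (fo_definable_inN foR)) => w; split.
    move=> [_ [u [v [-> Ruv]]] <-]; exists (inN pr \o u), (inN pr \o v).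
    by rewrite comp_env_cat; split=> //; exists u, v.
  move=> [_ [_ [-> [u [v [Ruv -> ->]]]]]].
  by exists (env_cat u v); rewrite ?comp_env_cat //; exists u, v.
- split.
  + by move=> _ _ [u [v [/RD[Du Dv] -> ->]]]; split; [exists u|exists v].
  + by move=> _ [u /Rr Ru <-]; exists u, u.
  + by move=> _ _ [u [v [/Rs Ruv -> ->]]]; exists v, u.
  + move=> _ _ _ [u [v [Ruv -> ->]]] [v' [w [Rvw /inN_comp_inj ev ->]]].
    by subst v'; exists u, w; split=> //; exact: Rt Rvw.
Qed.

Lemma comp_inN (s : aut M) n (t : 'I_n -> N) :
  s \o (inN pr \o t) = inN pr \o (resN s \o t).
Proof. by apply/funext => i /=; rewrite autN_funE. Qed.

Lemma fixes_imag_map (s : aut M) (e : imag N) :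
  fixes s (imag_map (inN pr) e) <-> fixes (resN s) e.
Proof.
have clsE (t : 'I_(ps_ar (im_sort e)) -> N) :
    im_cls (imag_map (inN pr) e) (inN pr \o t) <-> im_cls e t.
  by split=> [[u eu /inN_comp_inj <-]|et] //; exists t.
split=> [se t|se t].
  by rewrite -!clsE -comp_inN; exact: se.
split=> [[u eu eut]|[u eu <-]]; last first.
  by rewrite comp_inN clsE; exact/se.
(* A priori [t] is a tuple of M; it lies in N because its image under [s] does. *)
have eV : t = inN pr \o (resN s^-1%g \o u).
  by rewrite -comp_inN eut; apply/funext => i /=; rewrite (aut_funK s).
rewrite eV clsE -se.
suff -> : resN s \o (resN s^-1%g \o u) = u by [].
by apply/funext => i /=; rewrite -autN_fun_mul mulgV.
Qed.

(** The graph of [pr] is a basic relation of M. *)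
Lemma autN_pr (s : aut M) c : autN_fun s (pr c) = pr (autC_fun s c).
Proof.
have : @rel_of _ _ M (inr tt) (fun i => if i == ord0 then inC pr c else inN pr (pr c)).
  by exists c.
rewrite -(@aut_rel _ _ _ s (inr tt)) => -[c' /=].
by rewrite autC_funE autN_funE => -[[->] [->]].
Qed.

Lemma Aut_over_realNP (s : aut M) : Aut_over (realN pr) s <-> resN s = 1%g.
Proof.
split=> [sN|s1 _ [n _ <-]]; last first.
  apply/fixes_real; rewrite autN_funE; congr inN.
  exact: (congr1 (fun u : aut N => u n) s1).
apply: aut_ext => n /=.
have /fixes_real : fixes s (real (inN pr n)) by apply: sN; exists n.
by rewrite autN_funE => -[].
Qed.

Lemma resNM (s t : aut M) : resN (s * t)%g = (resN s * resN t)%g.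
Proof. by apply: aut_ext => n; exact: autN_fun_mul. Qed.

Hypothesis finM : finitary M.

(** * From a section to a definable point *)

Section SectionImaginary.
Variable g : {multiplicative aut N -> aut M}.
Hypothesis gP : is_section g.

Let A : set (imag M) := [set e | Meq e /\ forall h, range g h -> fixes h e].

Let g1 : g 1%g = 1%g.
Proof. by apply: (mulgI (g 1%g)); rewrite -gmulfM !mulg1. Qed.

(** The image of a continuous section is closed, because a limit [s] of its elements must equal
    [g (resN s)]. *)
Lemma Aut_over_section : Aut_over A = range g.
Proof.
have [gC gK] := gP.
apply: Aut_over_closed_subgroup => //.
- by exists 1%g.
- by move=> _ _ [s _ <-] [t _ <-]; exists (s * t)%g => //; rewrite gmulfM.
- move=> _ [s _ <-]; exists s^-1%g => //.
  by apply: (mulgI (g s)); rewrite -gmulfM !mulgV.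
move=> s sF; exists (resN s) => //; apply: aut_ext => y.
have [F [finF FP]] := gC (resN s) y.
(* Here [h] agrees with [resN s] on [F], which controls [g] at [y], while [g h] agrees with [s] at
   [y] itself. *)
have [|_ [h _ <-] sh] := sF (inN pr @` F `|` [set y]).
  by rewrite finite_setU; split; [exact: finite_image|].
rewrite (sh y); last by right.
symmetry; apply: FP => n Fn.
have := sh (inN pr n) (or_introl (ex_intro2 _ _ n Fn erefl)).
rewrite !autN_funE => -[e].
by rewrite -[RHS]/(autN_fun s n) e -[RHS]/(resN (g h) n) gK.
Qed.

(** The image of g meets Aut(M/N) trivially, so N and A together define every point of M. It maps
    onto Aut(N), so A adds no structure to N. *)
Lemma section_imaginary_section : section_imaginary A.
Proof.
have [gC gK] := gP.
have fixreal e s : range (@real _ _ M) e -> Aut_over A s ->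
    Aut_over (realN pr) s -> fixes s e.
  rewrite Aut_over_section => _ [h _ <-] /Aut_over_realNP; rewrite gK => ->.
  by rewrite g1 => t.
have realMeq : range (@real _ _ M) `<=` @Meq _ _ M.
  by move=> _ [m _ <-]; exact: Meq_real.
split.
- by move=> e [].
- split.
  + move=> r s _ t.
    exact: (@aut_rel _ _ M s (inl (inr r)) t).
  + move=> k R RA s _ t.
    have gsA : Aut_over A (g s) by rewrite Aut_over_section; exists s.
    have inR u : [set inN pr \o t | t in R] (inN pr \o u) <-> R u.
      by split=> [[v Rv /inN_comp_inj <-]|] //; exists u.
    by rewrite -(inR t) -(RA _ gsA) comp_inN gK inR.
  + by move=> e er; split; [exact: realMeq|move=> s; exact: fixreal].
- move=> e er; split; first exact: realMeq.
  by move=> s sA; apply: fixreal => // e' ?; apply: sA; [right|left].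
- apply/seteqP; split=> [e' [[_ e'A] [e [eMeq _] ee']]|_ [e [eMeq e0] <-]].
    exists e => //; split=> // s _; rewrite -(gK s) -fixes_imag_map.
    by rewrite ee'; apply: e'A; rewrite Aut_over_section; exists s.
  split.
    split; first exact: Meq_imag_map.
    by move=> s _; apply/fixes_imag_map/e0.
  exists e => //; split=> // s sN.
  (* Only the identity fixes N pointwise, so every imaginary of N is in the definable closure of
     N. *)
  suff -> : s = 1%g by move=> t.
  apply: aut_ext => n.
  by have /fixes_real : fixes s (real n) by apply: sN; exists n.
Qed.

Lemma definable_point_of_section : section_imaginaries_eliminable pr ->
  (exists s t : aut M,
    [/\ Aut_over (realN pr) s, Aut_over (realN pr) t & s <> t]) ->
  exists n : N, dcl set0 (real (inN pr n)).
Proof.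
have [gC gK] := gP; move=> elim [s [t [sN tN st]]].
have [A0 A0A] := elim _ section_imaginary_section.
have HA0 : Aut_over [set real (inC pr c) | c in A0] = range g.
  rewrite -Aut_over_dcl; last by move=> _ [c _ <-]; exact: Meq_real.
  by rewrite -A0A Aut_over_dcl ?Aut_over_section // => e [eMeq _].
have [[c A0c]|A0N] := pselect (A0 !=set0); last first.
  have rg (u : aut M) : Aut_over (realN pr) u -> u = 1%g.
    move=> /Aut_over_realNP u1.
    have : range g u by rewrite -HA0 => _ [c A0c <-]; case: A0N; exists c.
    by case=> h _ gh; move: u1; rewrite -gh gK => ->.
  by case: st; rewrite (rg _ sN) (rg _ tN).
exists (pr c); split; first exact: Meq_real.
move=> u _; apply/fixes_real; rewrite autN_funE; congr inN.
(* [u] may be replaced by [g (resN u)], which acts on N in the same way and fixes [c]. *)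
have : range g (g (resN u)) by exists (resN u).
rewrite -HA0 => gA0.
have /fixes_real : fixes (g (resN u)) (real (inC pr c)) by apply: gA0; exists c.
rewrite autC_funE => -[guc].
by rewrite -[autN_fun u _]/(resN u (pr c)) -(gK (resN u)) /= autN_pr guc.
Qed.

End SectionImaginary.

(** * From a definable point to a section *)

(** The orbit of a finite tuple of C is definable, so its image under [pr] is definable in N and
    preserved by [u]. Thus [u] is induced by automorphisms of M on each finite set, and compactness
    glues them. *)
Lemma resN_surjective : is_cover pr ->
  forall u : aut N, exists s : aut M, resN s = u.
Proof.
move=> [pr_surj _ pr_def] u.
have /choice[q qP] n : exists c, pr c = n by exact: pr_surj.
(* Points of N are replaced by chosen points of C above them. *)
pose p (x : M) : C := match x with inl c => c | inr n => q n end.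
have /choice[t tP] (F : set M) : exists s : aut M, finite_set F ->
    forall n, F (inN pr n) -> resN s n = u n.
  have [/finite_set_enum[k [x ->]]|] := pselect (finite_set F); last by exists 1%g.
  pose R : set ('I_k -> C) := [set v | exists s : aut M, v = autC_fun s \o (p \o x)].
  have Rdef : @definable _ _ M k [set inC pr \o v | v in R].
    move=> a _ v; split=> [[_ [s ->]] e|[_ [s ->] <-]]; last first.
      exists (autC_fun (a * s)%g \o (p \o x)); first by exists (a * s)%g.
      by apply/funext => i /=; rewrite -!autC_funE.
    exists (autC_fun (a^-1 * s)%g \o (p \o x)); first by exists (a^-1 * s)%g.
    apply/funext => i; have /= ei := congr1 (@^~ i) e.
    rewrite /= -autC_funE -(aut_funK a (v i)) -ei -autC_funE //.
  have uT : Aut_over set0 u by [].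
  have [|_ [s ->] su] := (pr_def k R Rdef u uT (pr \o (p \o x))).2.
    by exists (p \o x) => //; exists 1%g.
  exists s => _ n [i _ xi]; have /= := congr1 (@^~ i) su.
  by rewrite -autN_pr xi /= qP.
have [s sP] := aut_compact finM t; exists s; apply: aut_ext => n.
have [F [finF nF sF]] := sP _ (finite_set1 (inN pr n)).
rewrite -(tP F finF n); last exact: nF.
have /= := sF (inN pr n) erefl; rewrite !autN_funE => -[]; exact.
Qed.

End CoverStructure.

Section PointStabiliser.
Variables (LC LN : language unit) (C : structure LC) (N : structure LN).
Variable pr : C -> N.
Local Notation M := (cover_str pr).

Lemma aut_eq_of_point (hC1 : condC1 pr) (s t : aut M) c :
  resN s = resN t -> s (inC pr c) = t (inC pr c) -> s = t.
Proof.
move=> est ec; suff u1 : (s^-1 * t)%g = 1%g by rewrite -[t](mulVKg s) u1 mulg1.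
have uN : Aut_over (realN pr `|` [set real (inC pr c)]) (s^-1 * t)%g.
  move=> e [eN|->]; last first.
    by apply/fixes_real; rewrite -[LHS]/(aut_inv s (t (inC pr c))) -ec aut_funK.
  suff : Aut_over (realN pr) (s^-1 * t)%g by exact.
  by apply/Aut_over_realNP; rewrite resNM -est -resNM mulVg; exact: aut_ext.
apply: aut_ext => -[d|n].
  have [|_ fixd] := hC1 c (real (inC pr d)); first by exists d.
  by have /fixes_real := fixd _ uN.
by have /fixes_real := uN _ (or_introl (ex_intro2 _ _ n I erefl)).
Qed.

Lemma section_of_definable_point (finM : finitary M) :
  is_cover pr -> condC1 pr -> condC2 pr ->
  (exists n : N, dcl set0 (real (inN pr n))) ->
  exists g : {multiplicative aut N -> aut M}, is_section g.
Proof.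
move=> hcover hC1 [G [_ _ _ G_trans GE]] [n [_ n_fix]].
have [c cn] : exists c, pr c = n by case: hcover.
have /choice[g gP] (u : aut N) :
    exists s : aut M, resN s = u /\ s (inC pr c) = inC pr c.
  have [s su] := resN_surjective finM hcover u.
  have prc : pr (autC_fun s c) = pr c.
    rewrite -autN_pr cn.
    have /fixes_real : fixes s (real (inN pr n)) by exact: n_fix.
    by rewrite autN_funE => -[].
  (* As [n] is fixed, the lift keeps [c] in its fibre, and C2 supplies an element of Aut(M/N) that
     moves it back to [c]. *)
  have [f [[]]] := G_trans _ _ prc; rewrite GE => -[t tN <-] tsc _.
  exists (t * s)%g; split; first by rewrite resNM su (Aut_over_realNP t).1 // mul1g.
  by rewrite /= autC_funE autC_funE tsc.
have gM : {morph g : u v / (u * v)%g}.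
  move=> u v; apply: (aut_eq_of_point hC1 (c := c)).
    by rewrite resNM !(gP _).1.
  by rewrite /= !(gP _).2.
pose gm : {multiplicative aut N -> aut M} :=
  HB.pack g (isMultiplicative.Build (aut N) (aut M) g gM).
exists gm; split; last by move=> u; exact: (gP u).1.
(* If continuity fails at [u], there are [v F] agreeing with [u] on [F] with [g (v F) y] different
   from [g u y]. A cluster point of the [g (v F)] fixes [c] and induces [u], so it is [g u], yet it
   differs from [g u] at [y]. *)
move=> u y; apply: contrapT => /forallNP discont.
have /choice[v vP] (F : set M) : exists v : aut N, finite_set F ->
    (forall k, F (inN pr k) -> v k = u k) /\ g v y <> g u y.
  have [finF|] := pselect (finite_set F); last by exists 1%g.
  have finFN : finite_set (inN pr @^-1` F).
    by apply: finite_preimage => // k l _ _ [].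
  have /not_andP[//|/existsNP[v /not_implyP[vu ?]]] := discont (inN pr @^-1` F).
  by exists v.
have [s sP] := aut_compact finM (g \o v).
have limP x (P : M -> Prop) :
    (forall F, finite_set F -> F x -> P (g (v F) x)) -> P (s x).
  move=> FP; have [F [finF xF ->]] := sP _ (finite_set1 x) => //.
  by apply: FP => //; exact: xF.
suff su : s = g u.
  apply: (limP y (fun x => x <> g u y)); last by rewrite su.
  by move=> F finF _; exact: (vP F finF).2.
apply: (aut_eq_of_point hC1 (c := c)); last first.
  apply: (limP _ (fun x => x = g u (inC pr c))) => F _ _.
  by rewrite !(gP _).2.
rewrite (gP u).1; apply: aut_ext => k.
suff : s (inN pr k) = inN pr (u k) by rewrite autN_funE => -[].
apply: (limP _ (fun x => x = inN pr (u k))) => F finF Fk.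
rewrite autN_funE -((vP F finF).1 k Fk) -[in RHS](gP (v F)).1 //.
Qed.

End PointStabiliser.

Theorem theorem4p7 (LC LN : language unit) (C : structure LC) (N : structure LN)
    (pr : C -> N)
    (hcover : is_cover pr)
    (hfin : finitary (cover_str pr))
    (hC1 : condC1 pr)
    (hC2 : condC2 pr)
    (hC3 : uncountably_categorical (cover_str pr))
    (hnontriv : exists s t : aut (cover_str pr),
       [/\ Aut_over (realN pr) s, Aut_over (realN pr) t & s <> t])
    (helim : section_imaginaries_eliminable pr) :
  (exists g : {multiplicative aut N -> aut (cover_str pr)}, is_section g) <->
  (exists n : N, dcl set0 (real (inN pr n))).
Proof.
split=> [[g gP]|]; first exact: definable_point_of_section gP helim hnontriv.
exact: section_of_definable_point.
Qed.
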